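(* Let $T$ be a finite rooted tree with node set $\mathcal V$ and cost function $c:\mathcal V\to\mathbb R_{\ge0}$, let $B\ge1$ be an integer budget, and suppose that for every hypernode $\mathbf u$ with $S(\mathbf u)\ne\emptyset$ a probability distribution $P_{\mathbf u}$ on $H(\mathbf u)$ is given that assigns positive probability to every element of $H(\mathbf u)$. Let $\mathbf v$ be a nonempty hypernode. Then the output $C_{\mathrm{SEP}}(T_{\mathbf v})$ of the SEP algorithm started at $\mathbf v$ satisfies \[\mathbb E\big[C_{\mathrm{SEP}}(T_{\mathbf v})\big]=\frac{\mathrm{Cost}(T_{\mathbf v})}{|\mathbf v|},\] i.e. $|\mathbf v|C_{\mathrm{SEP}}(T_{\mathbf v})$ is an unbiased estimator of $\mathrm{Cost}(T_{\mathbf v})$.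
   Context: For a node $v$, $S(v)$ is its set of children and $T_v$ is the subtree rooted at $v$, with $\mathrm{Cost}(T_v)=\sum_{u\in T_v}c(u)$. A hypernode is a set of distinct nodes of $T$ all at the same depth. For a set of nodes $\mathbf v$: $c(\mathbf v)=\sum_{v\in\mathbf v}c(v)$, $S(\mathbf v)=\bigcup_{v\in\mathbf v}S(v)$, $T_{\mathbf v}=\bigcup_{v\in\mathbf v}T_v$, and $\mathrm{Cost}(T_{\mathbf v})=\sum_{v\in\mathbf v}\mathrm{Cost}(T_v)$. The hyperchildren of $\mathbf v$ are $H(\mathbf v)=\{\mathbf w\subseteq S(\mathbf v): |\mathbf w|=\min(B,|S(\mathbf v)|)\}$. SEP algorithm started at $\mathbf v$: set $k=0$, $\mathbf x_0=\mathbf v$, $D=1$, $C=c(\mathbf x_0)/|\mathbf x_0|$. Repeat: if $S(\mathbf x_k)=\emptyset$, stop and output $C_{\mathrm{SEP}}(T_{\mathbf v})=C$. Otherwise choose $\mathbf x_{k+1}\in H(\mathbf x_k)$ at random with probability $P(\mathbf x_{k+1}):=P_{\mathbf x_k}(\mathbf x_{k+1})$ (independently of earlier choices given $\mathbf x_k$), set $D_k=\frac{|\mathbf x_{k+1}|}{|\mathbf x_k|}\binom{|S(\mathbf x_k)|-1}{|\mathbf x_{k+1}|-1}^{-1}P(\mathbf x_{k+1})^{-1}$, $D\leftarrow D\cdot D_k$, $C\leftarrow C+\frac{c(\mathbf x_{k+1})}{|\mathbf x_{k+1}|}D$, and $k\leftarrow k+1$. *)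

(* Defs.v *)
From HB Require Import structures.
From mathcomp Require Import all_boot all_order all_algebra.

Set Implicit Arguments.
Unset Strict Implicit.
Unset Printing Implicit Defensive.

Import Order.TTheory GRing.Theory Num.Theory.
Local Open Scope ring_scope.

(* A rooted tree on a nonempty finite node set [V], given by its parent map.
   The root has no parent; it is encoded as the (unique) fixed point of
   [parent].  Every node reaches the root by iterating [parent]. *)
Record rooted_tree (V : finType) := RootedTree {
  root : V;
  parent : V -> V;
  parent_root : parent root = root;
  connect_root : forall u, fconnect parent u root
}.

Section Tree.
Variables (V : finType) (T : rooted_tree V).
Implicit Types (u w : V) (x y : {set V}).

Definition child_nodes u : {set V} :=
  [set w | (w != root T) && (parent T w == u)].

(* The least [n] such that the [n]-th iterate of [parent] sends [u] to the
   root. *)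
Definition depth u : nat := findex (parent T) u (root T).

Definition subtree u : {set V} := [set w | fconnect (parent T) w u].

Definition hypernode x : Prop := {in x &, forall u w, depth u = depth w}.

Definition children x : {set V} := \bigcup_(u in x) child_nodes u.

Definition hyperchildren (B : nat) x : {set {set V}} :=
  [set y : {set V} | (y \subset children x) && (#|y| == minn B #|children x|)].

Definition cost (R : realFieldType) (c : V -> R) x : R := \sum_(u in x) c u.

Definition subtree_cost (R : realFieldType) (c : V -> R) x : R :=
  \sum_(u in x) cost c (subtree u).

(* [p x y] is the probability P_x(y) of choosing [y] when standing at [x];
   its values for [y] outside [hyperchildren B x] are irrelevant. *)
Definition positive_choice_law (R : realFieldType) (B : nat)
    (p : {set V} -> {set V} -> R) : Prop :=
  forall x, hypernode x -> children x != set0 ->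
    (forall y, y \in hyperchildren B x -> 0 < p x y) /\
    \sum_(y in hyperchildren B x) p x y = 1.

Definition sep_factor (R : realFieldType) (p : {set V} -> {set V} -> R) x y : R :=
  #|y|%:R / #|x|%:R * ('C(#|children x|.-1, #|y|.-1)%:R)^-1 * (p x y)^-1.

(* The pair (D, C) after [k] iterations of the loop along the sequence of
   hypernodes [x]; once a hypernode without children is met, the pair is
   frozen. *)
Fixpoint sep_state (R : realFieldType) (c : V -> R)
    (p : {set V} -> {set V} -> R) (x : nat -> {set V}) (k : nat) : R * R :=
  if k is j.+1 then
    let: (D, C) := sep_state c p x j in
    if children (x j) == set0 then (D, C)
    else let D' := D * sep_factor p (x j) (x j.+1) in
         (D', C + cost c (x j.+1) / #|x j.+1|%:R * D')
  else (1, cost c (x 0%N) / #|x 0%N|%:R).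

(* The final value of C: the loop has stopped after [#|V|] iterations, see
   [sep_halts] below. *)
Definition C_SEP (R : realFieldType) (c : V -> R)
    (p : {set V} -> {set V} -> R) (x : nat -> {set V}) : R :=
  (sep_state c p x #|V|).2.

(* Possible trajectories: a trajectory stays put once the loop has stopped. *)
Definition sep_step (B : nat) x y : Prop :=
  if children x == set0 then y = x else y \in hyperchildren B x.

Lemma depth_child u w : w \in child_nodes u -> depth w = (depth u).+1.
Proof.
rewrite inE => /andP[nr /eqP <-]; rewrite /depth.
by apply: fconnect_findex; [exact: connect_root | rewrite eq_sym].
Qed.

Lemma depth_lt u : (depth u < #|V|)%N.
Proof.
apply: (leq_trans (findex_max (connect_root T u))); exact: max_card.
Qed.

Lemma sep_halts (B : nat) (x : nat -> {set V}) :
  (forall k, sep_step B (x k) (x k.+1)) -> children (x #|V|) = set0.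
Proof.
move=> hx; apply/eqP; apply: contraT => alive.
suff H k : children (x k) != set0 -> forall u, u \in x k -> (k <= depth u)%N.
  have [w /bigcupP[u xu _]] := set0Pn _ alive.
  by have := H _ alive u xu; rewrite leqNgt depth_lt.
elim: k => [//|k IH] alk u xu.
have := hx k; rewrite /sep_step; case: ifPn => [h0 e|hk].
  by rewrite e h0 in alk.
rewrite inE => /andP[/subsetP /(_ _ xu) /bigcupP[w xw /depth_child ->] _].
exact: IH hk w xw.
Qed.

End Tree.

From mathcomp Require Import all_classical all_reals all_analysis.

Local Open Scope classical_set_scope.

(* [X k w] is the hypernode x_k in outcome [w] of a run of the algorithm started
   at [v].  In [sep_law], [h] ranges over the possible histories
   x_0 = h 0, ..., x_k = h k: conditionally on the whole history, x_{k+1} has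
   law P_{x_k}. *)
Record sep_run (V : finType) (T : rooted_tree V) (B : nat) (R : realType)
    (p : {set V} -> {set V} -> R) (v : {set V})
    (d : measure_display) (Omega : measurableType d) (P : probability Omega R)
    (X : nat -> Omega -> {set V}) : Prop := SepRun {
  sep_start : forall w, X 0%N w = v;
  sep_trajectory : forall k w, sep_step T B (X k w) (X k.+1 w);
  sep_measurable : forall k y, measurable [set w | X k w = y];
  sep_law : forall k (h : nat -> {set V}) y,
    children T (h k) != finset.set0 -> y \in hyperchildren T B (h k) ->
    P [set w | (forall i, (i <= k)%N -> X i w = h i) /\ X k.+1 w = y] =
    ((p (h k) y)%:E * P [set w | forall i, (i <= k)%N -> X i w = h i])%E
}.

(* Main.v *)
(* Let C_k, D_k be the values of C and D after k steps.  Then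
     M_k = C_k + D_k Cost(T_{S(x_k)}) / |x_k|
   is a martingale: every node of S(x) lies in exactly 'C(|S(x)|-1, b-1) of the
   hyperchildren of x, where b is their common size, and D_k is normalized so
   that averaging Cost(T_y) / |y| over these hyperchildren gives back
   Cost(T_{S(x)}) / |x|.  Now M_0 = Cost(T_v) / |v|, while M_k = C_k once x_k has
   no children.  As there are finitely many histories, expectations are finite
   sums over them. *)
Require Import Defs.
From HB Require Import structures.
From mathcomp Require Import all_boot all_order all_algebra.
From mathcomp Require Import ring.

Set Implicit Arguments.
Unset Strict Implicit.
Unset Printing Implicit Defensive.

Import Order.TTheory GRing.Theory Num.Theory.
Local Open Scope ring_scope.

Section Tree.
Variables (V : finType) (T : rooted_tree V).
Implicit Types (u w z : V) (x y : {set V}).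

(** * Ancestry in the tree and the recursion for subtree costs *)

Lemma depth_parent z : z != Defs.root T -> depth T z = (depth T (parent T z)).+1.
Proof. by move=> zr; apply: depth_child; rewrite inE zr /=. Qed.

Lemma depth_fconnect z u :
  fconnect (parent T) z u -> (depth T u <= depth T z)%N.
Proof.
move/iter_findex <-; elim: findex => [//|n IH] /=.
apply: leq_trans IH; have [->|nr] := eqVneq (iter n (parent T) z) (Defs.root T).
  by rewrite parent_root.
by rewrite [in leqRHS]depth_parent.
Qed.

Lemma fconnect_root u : fconnect (parent T) (Defs.root T) u = (Defs.root T == u).
Proof.
apply/idP/eqP => [/iter_findex <- | -> //].
by elim: findex => //= n <-; rewrite parent_root.
Qed.

(** Depth drops strictly on passing to the parent of a non-root node, so no such node can be reached
    again. *)
Lemma fconnect_parent_acyclic z :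
  z != Defs.root T -> fconnect (parent T) (parent T z) z = false.
Proof.
move=> zr; apply/negP => /depth_fconnect.
by rewrite [depth T z]depth_parent // ltnn.
Qed.

(** Booleans are read as numbers, so that the sum also records that the subtrees of distinct
    children of [u] are disjoint and miss [u]. The induction is on the depth of [z], passing from
    [z] to its parent. *)
Lemma fconnect_childE z u :
  fconnect (parent T) z u =
  ((z == u) + \sum_(w in child_nodes T u) fconnect (parent T) z w)%N :> nat.
Proof.
move: {2}(depth T z) (leqnn (depth T z)) => n.
elim: n z => [|n IH] z; have [-> _|zr] := eqVneq z (Defs.root T).
- rewrite fconnect_root big1 ?addn0 // => w.
  by rewrite inE fconnect_root eq_sym => /andP[/negPf->].
- by rewrite depth_parent.
- rewrite fconnect_root big1 ?addn0 // => w.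
  by rewrite inE fconnect_root eq_sym => /andP[/negPf->].
rewrite depth_parent // ltnS => /IH {}IH.
(* By acyclicity the two alternatives exclude each other, hence the exact sum. *)
have stepE w : fconnect (parent T) z w =
    ((z == w) + fconnect (parent T) (parent T z) w)%N :> nat.
  rewrite fconnect_eqVf; have [<-|//] := eqVneq z w.
  by rewrite fconnect_parent_acyclic.
rewrite stepE; congr addn.
rewrite (eq_bigr _ (fun w _ => stepE w)).
rewrite big_split /= IH; congr addn.
(* What remains is that [z] is a child of its parent and of no other node. *)
have [pz|pz] := eqVneq (parent T z) u.
  rewrite (bigD1 z) /=; last by rewrite inE zr pz /=.
  rewrite !eqxx big1 // => w /andP[_]; by rewrite eq_sym => /negPf->.
rewrite big1 // => w; rewrite inE => /andP[_ /eqP pw].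
by apply/eqP; rewrite eqb0; apply: contraNneq pz => ->; apply/eqP.
Qed.

(** Each node has a single parent, so the sets of children of distinct nodes are disjoint. *)
Lemma sum_children (R : nmodType) (F : V -> R) x :
  \sum_(w in children T x) F w = \sum_(u in x) \sum_(w in child_nodes T u) F w.
Proof.
have chE w : (w \in children T x) = (w != Defs.root T) && (parent T w \in x).
  apply/bigcupP/andP => [[u xu]|[wr xp]].
    by rewrite inE => /andP[-> /eqP->].
  by exists (parent T w) => //; rewrite inE wr /=.
rewrite (partition_big (parent T) (mem x)) => [|w]; last first.
  by rewrite chE => /andP[].
apply: eq_bigr => u xu; apply: eq_bigl => w.
rewrite chE inE -andbA; congr andb.
by have [->|] := eqVneq (parent T w) u; rewrite ?xu ?andbF ?andbT.
Qed.

Lemma subtree_cost_children (R : realFieldType) (c : V -> R) x :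
  subtree_cost T c x = cost c x + subtree_cost T c (children T x).
Proof.
rewrite /subtree_cost sum_children /cost -big_split /=; apply: eq_bigr => u _.
(* Membership becomes a weight in a sum over all nodes, so that [fconnect_childE] can be applied for
   each [z] separately. *)
have sumE a : \sum_(z in subtree T a) c z =
    \sum_z c z *+ fconnect (parent T) z a.
  by rewrite big_mkcond; apply: eq_bigr => z _; rewrite inE; case: ifP.
rewrite sumE; under [X in _ = _ + X]eq_bigr do rewrite sumE.
have cuE : c u = \sum_z c z *+ (z == u).
  by rewrite (bigD1 u) //= eqxx big1 ?addr0 // => z /negPf->.
rewrite exchange_big /= cuE -big_split /=.
by apply: eq_bigr => z _; rewrite fconnect_childE mulrnDr sumrMnr.
Qed.

(** * Averaging over the hyperchildren of a hypernode *)

Lemma card_draws_in (S : {set V}) b u : u \in S ->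
  #|[set y : {set V} | (y \subset S) && (#|y| == b.+1) & u \in y]|
  = 'C(#|S|.-1, b).
Proof.
move=> Su; have -> : #|S|.-1 = #|S :\ u| by rewrite (cardsD1 u S) Su.
(* Inserting [u] is a bijection from the [b]-subsets of [S :\ u] onto the sets being counted. *)
rewrite -cards_draws -[RHS](card_in_imset (f := fun y => u |: y)); last first.
  move=> y z; rewrite !inE !subsetD1 => /andP[/andP[_ uy] _] /andP[/andP[_ uz] _].
  by move=> /(congr1 (fun y => y :\ u)); rewrite !setU1K.
apply: eq_card => y; rewrite inE; apply/andP/imsetP => [[/andP[yS yb] uy]|[z]].
  exists (y :\ u); last by rewrite setD1K.
  by rewrite inE setSD //=; move: yb; rewrite (cardsD1 u y) uy.
rewrite inE subsetD1 => /andP[/andP[zS uz] /eqP zb] ->.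
by rewrite setU11 subUset sub1set Su zS cardsU1 uz zb add1n eqxx.
Qed.

(** Double counting of the pairs [u \in y]. *)
Lemma sum_draws (R : pzSemiRingType) (F : V -> R) (S : {set V}) b :
  \sum_(y : {set V} | (y \subset S) && (#|y| == b.+1)) \sum_(u in y) F u =
  'C(#|S|.-1, b)%:R * \sum_(u in S) F u.
Proof.
rewrite (exchange_big_dep (mem S)) /= => [|y u /andP[/subsetP yS _] /yS //].
rewrite mulr_sumr; apply: eq_bigr => u Su.
rewrite sumr_const -(card_draws_in b Su) mulr_natl; congr (_ *+ _).
by apply: eq_card => y; rewrite !inE.
Qed.

Lemma hyperchildren_hypernode B x y :
  hypernode T x -> y \in hyperchildren T B x -> hypernode T y.
Proof.
move=> hx; rewrite inE => /andP[/subsetP yS _] a b /yS /bigcupP[u xu /depth_child ->].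
by move=> /yS /bigcupP[w xw /depth_child ->]; rewrite (hx u w).
Qed.

(** The probability and the size of [y] cancel against [sep_factor], leaving a weight independent of
    [y]. Its inverse binomial then cancels the multiplicity given by [sum_draws]. *)
Lemma sum_sep_factor (R : realFieldType) (B : nat)
    (p : {set V} -> {set V} -> R) (c : V -> R) x :
  (0 < B)%N -> positive_choice_law T B p -> hypernode T x ->
  children T x != set0 ->
  \sum_(y in hyperchildren T B x)
     p x y * (sep_factor T p x y * (subtree_cost T c y / #|y|%:R)) =
  subtree_cost T c (children T x) / #|x|%:R.
Proof.
move=> B0 hp hx S0; have [p_gt0 _] := hp x hx S0.
set b := minn B #|children T x|.
have x0 : #|x|%:R != 0 :> R.
  rewrite pnatr_eq0 cards_eq0; apply: contraNneq S0 => ->.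
  by rewrite /children big_set0.
have b0 : (0 < b)%N by rewrite leq_min B0 card_gt0.
(* This bound makes the binomial coefficient nonzero, hence invertible. *)
have bS : (b.-1 <= #|children T x|.-1)%N by rewrite -!subn1 leq_sub2r ?geq_minr.
have C0 : 'C(#|children T x|.-1, b.-1)%:R != 0 :> R.
  by rewrite pnatr_eq0 -lt0n bin_gt0.
transitivity (\sum_(y in hyperchildren T B x)
   ('C(#|children T x|.-1, b.-1)%:R^-1 / #|x|%:R) * subtree_cost T c y).
  apply: eq_bigr => y Hy; have py := lt0r_neq0 (p_gt0 y Hy).
  move: Hy; rewrite inE => /andP[_ /eqP yb]; rewrite /sep_factor yb -/b.
  have b0' : b%:R != 0 :> R by rewrite pnatr_eq0 -lt0n.
  by field; rewrite x0 C0 b0' py.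
rewrite -mulr_sumr /subtree_cost.
rewrite (eq_bigl (fun y : {set V} =>
  (y \subset children T x) && (#|y| == b.-1.+1))); last first.
  by move=> y; rewrite inE prednK.
by rewrite sum_draws mulrACA mulVf // mul1r mulrC.
Qed.

(** * The potential along a history and its one-step average *)

Section Potential.
Variables (R : realFieldType) (c : V -> R) (p : {set V} -> {set V} -> R).
Implicit Types h : nat -> {set V}.

(* M_k, i.e. the conditional expectation of the final C given the first [k]
   steps. *)
Definition sep_potential h k : R :=
  (sep_state T c p h k).2 +
  (sep_state T c p h k).1 * (subtree_cost T c (children T (h k)) / #|h k|%:R).

(* M_{k+1}, as a function of the history up to step [k] and of x_{k+1} = [y]. *)
Definition next_potential h k y : R :=
  if children T (h k) == set0 then sep_potential h k
  else (sep_state T c p h k).2 + (sep_state T c p h k).1 *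
         (sep_factor T p (h k) y * (subtree_cost T c y / #|y|%:R)).

(** This allows a trajectory to be replaced by any extension of its first [k.+1] entries. *)
Lemma eq_sep_state h h' k : (forall i, (i <= k)%N -> h i = h' i) ->
  sep_state T c p h k = sep_state T c p h' k.
Proof.
elim: k => [|k IH] hh' /=; first by rewrite hh'.
by rewrite IH ?hh' // => i ik; rewrite hh' // leqW.
Qed.

Lemma eq_sep_potential h h' k : (forall i, (i <= k)%N -> h i = h' i) ->
  sep_potential h k = sep_potential h' k.
Proof. by move=> hh'; rewrite /sep_potential (eq_sep_state hh') hh'. Qed.

Lemma eq_next_potential h h' k y : (forall i, (i <= k)%N -> h i = h' i) ->
  next_potential h k y = next_potential h' k y.
Proof.
move=> hh'; rewrite /next_potential (eq_sep_state hh') (eq_sep_potential hh').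
by rewrite hh'.
Qed.

(** The cost of the new hypernode, added to C, and the cost below it recombine by
    [subtree_cost_children]. *)
Lemma sep_potentialS B h k : sep_step T B (h k) (h k.+1) ->
  sep_potential h k.+1 = next_potential h k (h k.+1).
Proof.
rewrite /sep_step /next_potential /sep_potential /=.
case: (sep_state T c p h k) => D C /=; case: ifP => [_ -> //|_ _] /=.
by rewrite (subtree_cost_children c (h k.+1)); ring.
Qed.

Lemma sum_next_potential B h k : (0 < B)%N -> positive_choice_law T B p ->
  hypernode T (h k) -> children T (h k) != set0 ->
  \sum_(y in hyperchildren T B (h k)) next_potential h k y * p (h k) y =
  sep_potential h k.
Proof.
move=> B0 hp hx S0; have [_ sum_p] := hp _ hx S0.
rewrite /next_potential (negPf S0) /sep_potential.
(* The constant term C is multiplied by the total probability 1, so that both sides are sums over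
   the hyperchildren. *)
rewrite -(sum_sep_factor c B0 hp hx S0) -[X in X + _ * _]mulr1 -sum_p.
rewrite !mulr_sumr -big_split /=; apply: eq_bigr => y _; ring.
Qed.

Lemma sep_potential0 h : sep_potential h 0 = subtree_cost T c (h 0) / #|h 0|%:R.
Proof.
by rewrite /sep_potential /= mul1r -mulrDl -subtree_cost_children.
Qed.

Lemma sep_potential_halt h k : children T (h k) = set0 ->
  sep_potential h k = (sep_state T c p h k).2.
Proof.
by move=> h0; rewrite /sep_potential h0 /subtree_cost big_set0 mul0r mulr0 addr0.
Qed.

End Potential.

Lemma sep_step_hypernode B (h : nat -> {set V}) k :
  hypernode T (h 0) -> (forall i, sep_step T B (h i) (h i.+1)) ->
  hypernode T (h k).
Proof.
move=> h0 hS; elim: k => // k IH; move: (hS k); rewrite /sep_step.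
by case: ifP => [_ -> //|_]; exact: hyperchildren_hypernode.
Qed.

End Tree.

From mathcomp Require Import all_classical all_reals all_analysis.

Local Open Scope classical_set_scope.

(** * Expectations as finite sums *)

Section FiniteExpectation.
Context d (Omega : measurableType d) (R : realType) (P : probability Omega R).

Lemma expectation_finType (I : finType) (Y : Omega -> I) (f : I -> R) :
  (forall i, measurable [set w | Y w = i]) ->
  ('E_P[f \o Y] = (\sum_i f i * fine (P [set w | Y w = i]))%:E)%E.
Proof.
move=> mY; rewrite unlock.
(* At each outcome only the indicator with [i = Y w] is nonzero. *)
have fE w : ((f \o Y) w)%:E =
    (\sum_i (f i)%:E * (\1_[set w | Y w = i] w)%:E)%E.
  rewrite /= (bigD1 (Y w)) //= big1 ?adde0 => [|i iY].
    by rewrite indicE mem_set // mule1.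
  by rewrite indicE memNset ?mule0 // => /= wi; rewrite wi eqxx in iY.
under eq_integral do rewrite fE.
have mu_indic i : P.-integrable setT (fun w => (\1_[set w | Y w = i] w)%:E).
  exact: integrable_indic.
rewrite integral_sum //; last by move=> i; exact: integrableZl.
rewrite -sumEFin; apply: eq_bigr => i _.
rewrite integralZl // integral_indic // setIT EFinM fineK //.
exact: fin_num_measure.
Qed.

End FiniteExpectation.

(** * The martingale property along a random run *)

Section Run.
Variables (R : realType) (V : finType) (T : rooted_tree V) (c : V -> R).
Variables (B : nat) (p : {set V} -> {set V} -> R) (v : {set V}).
Context d (Omega : measurableType d) (P : probability Omega R).
Variable X : nat -> Omega -> {set V}.
Hypotheses (B_gt0 : (0 < B)%N) (p_law : positive_choice_law T B p).
Hypotheses (v_hyper : hypernode T v) (X_run : sep_run T B p v P X).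

(** Both expectations are expanded over the finitely many histories up to step [k] and compared
    history by history. *)
Lemma expectation_sep_potentialS k :
  ('E_P[fun w => sep_potential T c p (X^~ w) k.+1] =
   'E_P[fun w => sep_potential T c p (X^~ w) k])%E.
Proof.
pose hist w : {ffun 'I_k.+1 -> {set V}} := [ffun i => X (val i) w].
(* [inord] sends indices beyond [k] to 0; this is harmless, as only indices up to [k] are read. *)
pose ext (h : {ffun 'I_k.+1 -> {set V}}) i := h (inord i).
have histE w h : hist w = h <-> forall i, (i <= k)%N -> X i w = ext h i.
  split=> [<- i ik|Xh]; first by rewrite /ext ffunE /= inordK.
  apply/ffunP => i; rewrite ffunE Xh /ext ?inord_val //.
  exact: ltn_ord i.
have hist_set h :
    [set w | hist w = h] = [set w | forall i, (i <= k)%N -> X i w = ext h i].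
  by apply/seteqP; split => w /histE.
have m_hist h : measurable [set w | hist w = h].
  have -> : [set w | hist w = h] =
      \bigcap_(i in [set i | (i <= k)%N]) [set w | X i w = ext h i].
    by rewrite hist_set; apply/seteqP; split.
  by apply: bigcap_measurableType => i _; exact: sep_measurable X_run _ _.
have pair_set h y : [set w | (hist w, X k.+1 w) = (h, y)] =
    [set w | hist w = h] `&` [set w | X k.+1 w = y].
  by apply/seteqP; split => w /=; [case=> -> -> | case=> -> ->].
have m_pair hy : measurable [set w | (hist w, X k.+1 w) = hy].
  case: hy => h y; rewrite pair_set; apply: measurableI => //.
  exact: sep_measurable X_run _ _.
have -> : (fun w => sep_potential T c p (X^~ w) k.+1) =
    (fun hy => next_potential T c p (ext hy.1) k hy.2) \o
    (fun w => (hist w, X k.+1 w)).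
  apply/funext => w /=.
  rewrite (sep_potentialS c p (h := X^~ w) (sep_trajectory X_run k w)).
  by apply: eq_next_potential; apply/histE.
have -> : (fun w => sep_potential T c p (X^~ w) k) =
    (fun h => sep_potential T c p (ext h) k) \o hist.
  by apply/funext => w /=; apply: eq_sep_potential; apply/histE.
rewrite !expectation_finType //; congr EFin.
pose F h y := next_potential T c p (ext h) k y *
  fine (P [set w | (hist w, X k.+1 w) = (h, y)]).
transitivity (\sum_hy F hy.1 hy.2); first by apply: eq_bigr => -[].
rewrite -(pair_bigA _ F) /F /=; apply: eq_bigr => h _.
(* A history that never occurs contributes zero to both sides. Otherwise an outcome [w0] realizes
   it, and its trajectory shows that [ext h k] is a hypernode. *)
have [/eqP E0|/set0P[w0 hw0]] := boolP ([set w | hist w = h] == set0).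
  rewrite E0 measure0 mulr0 big1 // => y _.
  by rewrite pair_set E0 set0I measure0 mulr0.
have hk w : hist w = h -> X k w = ext h k by move=> /histE; exact.
have hyp : hypernode T (ext h k).
  rewrite -(hk _ hw0); apply: (sep_step_hypernode (B := B) (h := X^~ w0)).
    by rewrite (sep_start X_run).
  by move=> i; exact: sep_trajectory X_run _ _.
have step w : hist w = h -> sep_step T B (ext h k) (X k.+1 w).
  by move=> /hk <-; exact: sep_trajectory X_run _ _.
(* Once the loop has stopped, the trajectory stays put, so only [y = ext h k] contributes. *)
have [S0|S0] := eqVneq (children T (ext h k)) finset.set0.
  rewrite (bigD1 (ext h k)) //= big1 ?addr0 => [|y yk].
    rewrite /next_potential S0 eqxx; congr (_ * fine (P _)).
    rewrite pair_set; apply/seteqP; split => w /=; first by case.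
    by move=> hw; split => //; move: (step _ hw); rewrite /sep_step S0 eqxx.
  rewrite pair_set (_ : _ `&` _ = set0) ?measure0 ?mulr0 //.
  apply/seteqP; split => // w /= [/step]; rewrite /sep_step S0 eqxx => -> yE.
  by rewrite yE eqxx in yk.
rewrite -(sum_next_potential c B_gt0 p_law hyp S0) mulr_suml.
rewrite [RHS]big_mkcond; apply: eq_bigr => y _; case: ifPn => yH.
  rewrite -mulrA; congr (_ * _); rewrite pair_set hist_set.
  rewrite -[LHS]/(fine (P [set w | (forall i, (i <= k)%N -> X i w = ext h i) /\
    X k.+1 w = y])) (sep_law X_run S0 yH) fineM //.
  by rewrite -hist_set; exact: fin_num_measure.
(* A set outside the hyperchildren is never chosen, so the joint event is empty. *)
rewrite pair_set (_ : _ `&` _ = set0) ?measure0 ?mulr0 //.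
apply/seteqP; split => // w /= [/step]; rewrite /sep_step (negPf S0) => + yE.
by rewrite yE (negPf yH).
Qed.

Lemma expectation_sep_potential k :
  ('E_P[fun w => sep_potential T c p (X^~ w) k] =
   (subtree_cost T c v / #|v|%:R)%:E)%E.
Proof.
elim: k => [|k <-]; last exact: expectation_sep_potentialS.
rewrite -(expectation_cst P); congr expectation; apply/funext => w /=.
by rewrite sep_potential0 (sep_start X_run).
Qed.

End Run.

Theorem theorem1 (R : realType) (V : finType) (T : rooted_tree V)
    (c : V -> R) (c_ge0 : forall u : V, 0 <= c u)
    (B : nat) (B_ge1 : (1 <= B)%N)
    (p : {set V} -> {set V} -> R) (p_law : positive_choice_law T B p)
    (v : {set V}) (v_hyper : hypernode T v) (v_neq0 : v != finset.set0)
    (d : measure_display) (Omega : measurableType d) (P : probability Omega R)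
    (X : nat -> Omega -> {set V}) (X_run : sep_run T B p v P X) :
  ('E_P[(fun w => C_SEP T c p (fun k => X k w))] =
   (subtree_cost T c v / #|v|%:R)%:E)%E.
Proof.
(* At time [#|V|] the loop has stopped by [sep_halts], so the potential equals the output C. *)
rewrite -(expectation_sep_potential c B_ge1 p_law v_hyper X_run #|V|).
congr expectation; apply/funext => w; rewrite sep_potential_halt //.
exact: (sep_halts (x := X^~ w) (sep_trajectory X_run ^~ w)).
Qed.
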